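(* Fix an iteration index $t$ and an agent $p$. Let $w^{t+1},\lambda^t_p,z^t_p\in\mathbb{R}^{J\times K}$, $\rho^t>0$ and $\eta^t>0$ be given and independent of the data. For a dataset $\mathcal{D}$ and a noise vector $\xi\in\mathbb{R}^{J\times K}$ put $$G^t(z;\mathcal{D},\xi)=\langle f'_p(z^t_p;\mathcal{D}),z\rangle+\tfrac{\rho^t}{2}\big\|w^{t+1}-z+\tfrac{1}{\rho^t}(\lambda^t_p-\xi)\big\|^2,$$ and let $$z^{t+1}_p(\mathcal{D})=\operatorname{argmin}_{z\in\mathcal{W}}\ G^t(z;\mathcal{D},\tilde\xi^t_p)+\tfrac{1}{2\eta^t}\|z-z^t_p\|^2,$$ where $\tilde\xi^t_p$ is a random vector in $\mathbb{R}^{J\times K}$ whose entries are i.i.d. Laplace with mean $0$ and scale $\bar\Delta^t_p/\bar\epsilon$, i.e. with joint density proportional to $\exp(-\bar\epsilon\|\tilde\xi^t_p\|_1/\bar\Delta^t_p)$, where $\bar\epsilon>0$ and $$\bar\Delta^t_p=\max_{\mathcal{D}'_p\in\widehat{\mathcal{D}}_p}\|f'_p(z^t_p;\mathcal{D}_p)-f'_p(z^t_p;\mathcal{D}'_p)\|_1 ,$$ the same noise distribution being used whether the input is $\mathcal{D}_p$ or a neighbouring dataset. Then for all measurable $\mathcal{S}\subset\mathbb{R}^{J\times K}$ and all $\mathcal{D}'_p\in\widehat{\mathcal{D}}_p$, $$e^{-\bar\epsilon}\,\mathbb{P}(z^{t+1}_p(\mathcal{D}'_p)\in\mathcal{S})\le\mathbb{P}(z^{t+1}_p(\mathcal{D}_p)\in\mathcal{S})\le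 e^{\bar\epsilon}\,\mathbb{P}(z^{t+1}_p(\mathcal{D}'_p)\in\mathcal{S}).$$
   Context: Setting: $P,J,K$ positive integers; matrices in $\mathbb{R}^{J\times K}$ carry the Frobenius inner product $\langle\cdot,\cdot\rangle$ and norm $\|\cdot\|$, and $\|\cdot\|_1$ is the entrywise $\ell_1$-norm. Agent $p\in[P]$ holds a dataset $\mathcal{D}_p=\{(x_{pi},y_{pi})\}_{i=1}^{I_p}$ with $x_{pi}\in\mathbb{R}^J$, $y_{pi}\in\mathbb{R}^K$; $I=\sum_{p}I_p$. Let $\varphi(\cdot;x,y)$ be a convex loss on $\mathbb{R}^{J\times K}$, $r$ a convex regularizer on $\mathbb{R}^{J\times K}$, $\beta>0$, and $f_p(z;\mathcal{D}_p)=\frac1I\sum_{i=1}^{I_p}\varphi(z;x_{pi},y_{pi})+\frac{\beta}{P}r(z)$; $f'_p(z;\mathcal{D})$ denotes a (fixed) subgradient of $f_p(\cdot;\mathcal{D})$ at $z$. $\mathcal{W}\subset\mathbb{R}^{J\times K}$ is a compact convex set written as $\mathcal{W}=\{z:h_m(z)\le0,\ m\in[M]\}$ with each $h_m$ convex and twice continuously differentiable. $\widehat{\mathcal{D}}_p$ is the collection of datasets differing from $\mathcal{D}_p$ in a single entry. The objective above is strongly convex in $z$, so the minimizer is unique. *)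

(* Defs.v *)
From HB Require Import structures.
From mathcomp Require Import all_boot all_order all_algebra.
From mathcomp Require Import all_classical all_reals all_analysis.
Set Implicit Arguments. Unset Strict Implicit. Unset Printing Implicit Defensive.
Import Order.TTheory GRing.Theory Num.Theory.
Import numFieldNormedType.Exports.
Local Open Scope classical_set_scope.
Local Open Scope ring_scope.

Section defs.
Variable R : realType.

Definition frob {J K : nat} (A B : 'M[R]_(J, K)) : R :=
  \sum_(i < J) \sum_(j < K) A i j * B i j.
Definition frob_sq {J K : nat} (A : 'M[R]_(J, K)) : R := frob A A.
Definition l1norm {J K : nat} (A : 'M[R]_(J, K)) : R :=
  \sum_(i < J) \sum_(j < K) `|A i j|.

Definition mx_convex_fun {J K : nat} (f : 'M[R]_(J, K) -> R) : Prop :=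
  forall (x y : 'M[R]_(J, K)) (a : R), 0 <= a <= 1 ->
    f (a *: x + (1 - a) *: y) <= a * f x + (1 - a) * f y.
Definition mx_convex_set {J K : nat} (W : set 'M[R]_(J, K)) : Prop :=
  forall (x y : 'M[R]_(J, K)) (a : R), 0 <= a <= 1 ->
    W x -> W y -> W (a *: x + (1 - a) *: y).

Definition mx_C2 {J K : nat} (h : 'M[R]_(J, K) -> R) : Prop :=
  forall u v : 'M[R]_(J, K),
    (forall x, derivable h x u) /\
    (forall x, derivable (fun y => 'D_u h y) x v) /\
    continuous (fun y => 'D_v (fun z => 'D_u h z) y).

Definition dataset (J K Ip : nat) := 'I_Ip -> 'rV[R]_J * 'rV[R]_K.

Definition neighbor {J K Ip : nat} (D D' : dataset J K Ip) : Prop :=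
  exists i : 'I_Ip, D' i <> D i /\ forall k, k <> i -> D' k = D k.

Definition f_loc {J K Ip : nat} (I P : nat) (beta : R)
  (phi : 'M[R]_(J, K) -> 'rV[R]_J -> 'rV[R]_K -> R) (r : 'M[R]_(J, K) -> R)
  (D : dataset J K Ip) (z : 'M[R]_(J, K)) : R :=
  (I%:R)^-1 * (\sum_(i < Ip) phi z (D i).1 (D i).2) + beta / P%:R * r z.

Definition is_subgradient {J K : nat} (f : 'M[R]_(J, K) -> R)
  (z g : 'M[R]_(J, K)) : Prop :=
  forall z', f z + frob g (z' - z) <= f z'.

(* sigma-algebra on R^{JxK}: generated by the coordinate cylinders
   {M | M i j \in A}, A Borel (= the Borel sigma-algebra of R^{JxK}) *)
Definition mx_measurable {J K : nat} (S : set 'M[R]_(J, K)) : Prop :=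
  <<s [set C | exists (i : 'I_J) (j : 'I_K) (A : set R),
           measurable A /\ C = [set M : 'M[R]_(J, K) | A (M i j)]] >> S.

Definition laplace_law (b : R) (A : set R) : \bar R :=
  if 0 < b then (\int[lebesgue_measure]_(x in A) (expR (- `|x| / b) / (2 * b))%:E)%E
  else \d_(0 : R) A.

End defs.

Definition is_laplace_rv (R : realType) (d : measure_display)
  (Omega : measurableType d) (P : probability Omega R) (X : Omega -> R) (b : R)
  : Prop :=
  measurable_fun setT X /\
  forall A : set R, measurable A -> P (X @^-1` A) = laplace_law b A.

Definition mx_entries_indep (R : realType) (d : measure_display)
  (Omega : measurableType d) (P : probability Omega R) (J K : nat)
  (xi : Omega -> 'M[R]_(J, K)) : Prop :=
  forall A : 'I_J -> 'I_K -> set R, (forall i j, measurable (A i j)) ->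
    P [set w | forall i j, A i j (xi w i j)] =
    (\prod_(i < J) \prod_(j < K) P [set w | A i j (xi w i j)])%E.

(* Main.v *)
(* Completing the square, the update is the Euclidean projection onto W of
   ((data-independent matrix) - (f'_p(z^t_p; D) + xi)) / (rho + 1/eta), so passing
   from D to D' amounts to shifting the noise by the difference c of the two
   subgradients. Projections are nonexpansive, hence the update is a continuous
   function of the noise and pulls Borel sets back to Borel sets. The Laplace
   density changes by a factor at most exp(|c_ij| eps / Delta) when the entry
   (i, j) is shifted by c_ij; shifting the entries one at a time, and using
   Fubini for the independent entry being shifted, costs in total a factor
   exp(||c||_1 eps / Delta) <= exp(eps). *)

Require Import Defs.
From HB Require Import structures.
From mathcomp Require Import all_boot all_order all_algebra.
From mathcomp Require Import all_classical all_reals all_analysis.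
From mathcomp Require Import measurable_realfun.
From mathcomp Require Import ring lra.
Import Order.TTheory GRing.Theory Num.Theory.
Import numFieldNormedType.Exports.
Local Open Scope classical_set_scope.
Local Open Scope ring_scope.

(** * The Borel sigma-algebra of the matrix space *)

Definition mx_cylinders (R : realType) (J K : nat) : set (set 'M[R]_(J, K)) :=
  [set C | exists (i : 'I_J) (j : 'I_K) (A : set R),
           measurable A /\ C = [set M : 'M[R]_(J, K) | A (M i j)]].
(* [mx_measurable] is convertible to measurability in this type. *)
Notation borel_mx R J K := (g_sigma_algebraType (@mx_cylinders R J K)).

Lemma measurable_box {R : realType} {J K : nat} (A : 'I_J -> 'I_K -> set R) :
  (forall i j, measurable (A i j)) ->
  measurable [set M : borel_mx R J K | forall i j, A i j (M i j)].
Proof.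
move=> mA; rewrite [X in measurable X](_ : _ =
    \bigcap_(ij in [set: 'I_J * 'I_K])
      [set M : borel_mx R J K | A ij.1 ij.2 (M ij.1 ij.2)]); last first.
  by apply/seteqP; split => [M AM [i j] _|M AM i j]; [exact: AM|exact: (AM (i, j))].
apply: fin_bigcap_measurable; first exact: finite_finset.
by move=> [i j] _; apply: sub_sigma_algebra; exists i, j, (A i j).
Qed.

Lemma measurable_fun_mx {R : realType} {J K : nat} {d : measure_display}
    {T : measurableType d} (f : T -> borel_mx R J K) :
  (forall i j, measurable_fun setT (fun t => f t i j)) -> measurable_fun setT f.
Proof.
move=> mf.
apply: (@measurability _ _ T (borel_mx R J K) _ _ (@mx_cylinders R J K)) => //.
move=> _ [_ [i [j [A [mA ->]]]] <-].
exact: (mf i j measurableT A mA).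
Qed.

Lemma measurable_entry {R : realType} {J K : nat} (i : 'I_J) (j : 'I_K) :
  measurable_fun setT (fun M : borel_mx R J K => M i j).
Proof.
by move=> _ A mA; rewrite setTI; apply: sub_sigma_algebra; exists i, j, A.
Qed.

(** Every point of [U] lies in a box with rational corners contained in [U], and there are only
    countably many such boxes. *)
Lemma open_mx_measurable {R : realType} {J K : nat} (U : set 'M[R]_(J, K)) :
  open U -> mx_measurable U.
Proof.
move=> oU.
pose box (q : 'M[rat]_(J, K) * 'M[rat]_(J, K)) : set 'M[R]_(J, K) :=
  [set M | forall i j, `]ratr (q.1 i j), ratr (q.2 i j)[%classic (M i j)].
pose F q := [set M | box q M /\ box q `<=` U].
suff -> : U = \bigcup_q F q.
  apply: (@countable_bigcupT_measurable _ (borel_mx R J K) _ F).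
    exact: countableP.
  move=> q; have [bU|bU] := pselect (box q `<=` U).
    rewrite (_ : F q = box q); last first.
      by apply/seteqP; split => [M []|M].
    exact: (measurable_box (fun i j => `]ratr (q.1 i j), ratr (q.2 i j)[%classic)).
  by rewrite (_ : F q = set0)//; apply/seteqP; split => [M []|M].
apply/seteqP; split; last by move=> M [q _ [bM]]; apply.
move=> M UM; move: oU; rewrite openE => /(_ M UM) [P PM PU].
(* Neighbourhoods of a matrix are taken entry by entry, so each entry can be enclosed separately
   between two rationals. *)
have H i j : exists q : rat * rat,
    `]ratr q.1, ratr q.2[%classic (M i j) /\
    `]ratr q.1, ratr q.2[%classic `<=` P i j.
  have /nbhs_ballP[e /= e0 eP] := PM i j.
  have /rat_in_itvoo[l] : M i j - e < M i j by rewrite ltrBlDr ltrDl.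
  rewrite in_itv/= => /andP[l1 l2].
  have /rat_in_itvoo[u] : M i j < M i j + e by rewrite ltrDl.
  rewrite in_itv/= => /andP[u1 u2].
  exists (l, u); split => /=; first by rewrite in_itv/= l2 u1.
  move=> x /=; rewrite in_itv/= => /andP[lx xu]; apply: eP.
  by rewrite /ball/= ltr_distlC (lt_trans l1 lx) (lt_trans xu u2).
exists (\matrix_(i, j) (sval (cid (H i j))).1,
        \matrix_(i, j) (sval (cid (H i j))).2) => //.
split => [i j|N bN].
  by rewrite !mxE; exact: (svalP (cid (H i j))).1.
apply: PU => i j; apply: (svalP (cid (H i j))).2.
by have := bN i j; rewrite /= !mxE.
Qed.

(** Each entry of [f] is a continuous real function, so open intervals, which generate the Borel
    sets of the line, pull back to open sets. *)
Lemma continuous_mx_measurable {R : realType} {J K : nat}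
    (f : 'M[R]_(J, K) -> 'M[R]_(J, K)) :
  continuous f ->
  measurable_fun setT (f : borel_mx R J K -> borel_mx R J K).
Proof.
move=> cf; apply: measurable_fun_mx => i j.
apply: (measurability _ (RGenOpens.measurableE R)).
move=> _ [_ [a [b ->]] <-]; rewrite setTI; apply: open_mx_measurable.
have : continuous ((fun M : 'M[R]_(J, K) => M i j) \o f).
  by move=> x; apply: continuous_comp; [exact: cf|exact: coord_continuous].
by move/continuousP; apply; exact: interval_open.
Qed.

(** * Translating one independent entry, then all of them *)

Definition set_entry {R : realType} {J K : nat} (i : 'I_J) (j : 'I_K)
    (M : 'M[R]_(J, K)) (x : R) : 'M[R]_(J, K) :=
  \matrix_(k, l) if (k == i) && (l == j) then x else M k l.

Lemma measurable_set_entry {R : realType} {J K : nat} (i : 'I_J) (j : 'I_K) :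
  measurable_fun setT
    (fun p : borel_mx R J K * R => set_entry i j p.1 p.2 : borel_mx R J K).
Proof.
apply: measurable_fun_mx => k l; rewrite /set_entry.
under eq_fun do rewrite mxE.
case: ((k == i) && (l == j)); first exact: measurable_snd.
by apply: (measurableT_comp (measurable_entry k l)); exact: measurable_fst.
Qed.

(** Independence as a property of a law on matrices; for the law of a random matrix it unfolds to
    [mx_entries_indep]. *)
Definition indep_law {R : realType} {J K : nat}
    (mu : set (borel_mx R J K) -> \bar R) : Prop :=
  forall A : 'I_J -> 'I_K -> set R, (forall i j, measurable (A i j)) ->
    mu [set M : borel_mx R J K | forall i j, A i j (M i j)] =
    (\prod_(i < J) \prod_(j < K) mu [set M : borel_mx R J K | A i j (M i j)])%E.

(* A Dynkin argument on boxes: by independence, replacing one entry by a fresh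
   copy of itself does not change the law. *)
Lemma indep_law_resample {R : realType} {J K : nat} (i : 'I_J) (j : 'I_K)
    (mu : probability (borel_mx R J K) R) (nu : probability R R)
    (B : set 'M[R]_(J, K)) :
  indep_law mu ->
  (forall A, measurable A -> nu A = mu [set M : borel_mx R J K | A (M i j)]) ->
  mx_measurable B ->
  mu B = (mu \x nu)%E [set p | B (set_entry i j p.1 p.2)].
Proof.
move=> ind nuE mB.
pose Phi : {mfun (borel_mx R J K * R)%type >-> borel_mx R J K} :=
  mfun_Sub (mem_set (measurable_set_entry i j)).
pose G : set (set (borel_mx R J K)) :=
  [set C | exists2 A : 'I_J -> 'I_K -> set R, (forall i j, measurable (A i j))
     & C = [set M : borel_mx R J K | forall i j, A i j (M i j)]].
have GT : G setT.
  exists (fun _ _ => setT); first by [].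
  by apply/seteqP; split.
rewrite -[RHS]/(pushforward (mu \x nu)%E Phi B).
apply: (measure_unique G (fun=> setT)) => //.
- apply/seteqP; split.
    apply: smallest_sub; first exact: smallest_sigma_algebra.
    move=> _ [k [l [A [mA ->]]]]; apply: sub_sigma_algebra.
    (* A cylinder is the box whose other sides are the whole line, so boxes and cylinders generate
       the same sigma-algebra. *)
    exists (fun k' l' => if (k' == k) && (l' == l) then A else setT).
      by move=> k' l'; case: ifP.
    apply/seteqP; split => [M AM k' l'|M /(_ k l)]; last by rewrite !eqxx.
    by case: ifP => // /andP[/eqP-> /eqP->].
  apply: smallest_sub; first exact: smallest_sigma_algebra.
  by move=> _ [A mA ->]; exact: measurable_box.
- move=> _ _ [A mA ->] [A' mA' ->]; exists (fun k l => A k l `&` A' k l).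
    by move=> k l; exact: measurableI.
  by apply/seteqP; split => [M [AM AM'] k l|M AM]; [|split => k l; have [] := AM k l].
- by rewrite bigcup_const.
- move=> _ [A mA ->].
  (* Since entry [(i, j)] is overwritten, its constraint passes to the fresh variable: [A'] frees
     that side, and the preimage of the box becomes a product set. *)
  pose A' (k : 'I_J) (l : 'I_K) := if (k == i) && (l == j) then setT else A k l.
  have mA' k l : measurable (A' k l) by rewrite /A'; case: ifP.
  rewrite /= /pushforward (_ : _ @^-1` _ =
      [set M : borel_mx R J K | forall k l, A' k l (M k l)] `*` A i j); last first.
    apply/seteqP; split => -[M x] /=.
      move=> AMx; split => [k l|]; last by have := AMx i j; rewrite mxE !eqxx.
      by have := AMx k l; rewrite mxE /A'; case: ifP.
    move=> [AM Ax] k l; have := AM k l; rewrite mxE /A'.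
    by case: ifP => // /andP[/eqP-> /eqP->].
  rewrite product_measure1E//; last exact: measurable_box.
  have muT : mu [set M : borel_mx R J K | [set: R] (M i j)] = 1%E.
    by rewrite -(probability_setT mu); congr (mu _); apply/seteqP; split.
  transitivity (mu [set M : borel_mx R J K | forall k l, A' k l (M k l)] *
                mu [set M : borel_mx R J K | A i j (M i j)])%E; last first.
    by congr (_ * _)%E; exact/esym/nuE.
  rewrite !ind// (bigD1 i)//= [in RHS](bigD1 i)//= (bigD1 j)//=.
  rewrite [in RHS](bigD1 j)//= {1}/A' !eqxx/= muT mul1e.
  rewrite -[LHS]muleA muleC; congr (_ * _ * _)%E.
    by apply: eq_bigr => l lj; rewrite /A' (negbTE lj) andbF.
  apply: eq_bigr => k ki; apply: eq_bigr => l _.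
  by rewrite /A' (negbTE ki).
- by move=> _; rewrite -ge0_fin_numE// fin_num_measure.
Qed.

Lemma measurable_mx_shift {R : realType} {J K : nat} (c : 'M[R]_(J, K))
    {B : set 'M[R]_(J, K)} :
  mx_measurable B -> mx_measurable [set M | B (M + c)].
Proof.
move=> mB; rewrite -[X in mx_measurable X]setTI.
have cD : continuous (fun M : 'M[R]_(J, K) => M + c).
  by move=> M; apply: continuousD; [exact: cvg_id|exact: cst_continuous].
exact: (continuous_mx_measurable _ cD).
Qed.

Lemma indep_law_shift_entry {R : realType} {J K : nat} (i : 'I_J) (j : 'I_K)
    (mu : probability (borel_mx R J K) R) (c C : R) (B : set 'M[R]_(J, K)) :
  indep_law mu -> 0 <= C ->
  (forall A : set R, measurable A ->
    mu [set M : borel_mx R J K | A (M i j + c)%R]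
    <= C%:E * mu [set M : borel_mx R J K | A (M i j)])%E ->
  mx_measurable B ->
  (mu [set M | B (M + c *: delta_mx i j)%R] <= C%:E * mu B)%E.
Proof.
move=> ind C0 shift1 mB.
pose entry : {mfun borel_mx R J K >-> R} :=
  mfun_Sub (mem_set (measurable_entry i j)).
pose nu : probability R R := distribution mu entry.
have mE (B' : set 'M[R]_(J, K)) : mx_measurable B' ->
    measurable [set p : borel_mx R J K * R | B' (set_entry i j p.1 p.2)].
  by move=> mB'; rewrite -[X in measurable X]setTI; exact: measurable_set_entry.
have mBc := measurable_mx_shift (c *: delta_mx i j) mB.
rewrite !(indep_law_resample i j mu nu)//.
rewrite /product_measure1 -ge0_integralZl//; last first.
  exact: (measurable_fun_xsection nu (mE _ mB)).
apply: ge0_le_integral => //.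
- exact: (measurable_fun_xsection nu (mE _ mBc)).
- by apply: measurable_funeM; exact: (measurable_fun_xsection nu (mE _ mB)).
move=> y _ /=.
set E2 := xsection [set p : borel_mx R J K * R | B (set_entry i j p.1 p.2)] y.
(* On a section with the other entries frozen, adding [c *: delta_mx i j] is translation of the line
   by [c]. *)
rewrite (_ : xsection _ _ = [set x | E2 (x + c)]).
  by apply: shift1; exact: (measurable_xsection y (mE _ mB)).
apply/seteqP; split => x; rewrite /E2 /xsection/= !inE/=;
  rewrite (_ : set_entry i j y x + _ = set_entry i j y (x + c))//;
  apply/matrixP => k l; rewrite !mxE; case: ifP => _;
  by rewrite ?mulr1 ?mulr0 ?addr0.
Qed.

(** Expanding [c] in elementary matrices splits the shift into one-entry shifts; their factors
    multiply, so the exponents [k i j] add up. *)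
Lemma indep_law_shift {R : realType} {J K : nat}
    (mu : probability (borel_mx R J K) R) (c : 'M[R]_(J, K))
    (k : 'I_J -> 'I_K -> R) (B : set 'M[R]_(J, K)) :
  indep_law mu ->
  (forall i j (A : set R), measurable A ->
    mu [set M : borel_mx R J K | A (M i j + c i j)%R]
    <= (expR (k i j))%:E * mu [set M : borel_mx R J K | A (M i j)])%E ->
  mx_measurable B ->
  (mu [set M | B (M + c)%R] <=
    (expR (\sum_(i < J) \sum_(j < K) k i j)%R)%:E * mu B)%E.
Proof.
move=> ind shift1.
pose good (v : 'M[R]_(J, K)) (s : R) := forall B', mx_measurable B' ->
  (mu [set M | B' (M + v)%R] <= (expR s)%:E * mu B')%E.
have good0 : good 0 0.
  move=> B' mB'; rewrite expR0 mul1e le_eqVlt; apply/orP; left; apply/eqP.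
  by congr (mu _); apply/seteqP; split => M /=; rewrite addr0.
(* The bound for [v1] is applied to the set already translated by [v2]. *)
have goodD v1 s1 v2 s2 : good v1 s1 -> good v2 s2 -> good (v1 + v2) (s1 + s2).
  move=> g1 g2 B' mB'; rewrite expRD EFinM -muleA.
  apply: (@le_trans _ _ ((expR s1)%:E * mu [set M | B' (M + v2)%R])%E).
    apply: le_trans (g1 _ (measurable_mx_shift v2 mB')).
    rewrite le_eqVlt; apply/orP; left; apply/eqP.
    by congr (mu _); apply/seteqP; split => M /=; rewrite addrA.
  by rewrite lee_pmul2l ?lte_fin ?expR_gt0//; exact: g2.
suff : good c (\sum_(i < J) \sum_(j < K) k i j) by apply.
rewrite [c]matrix_sum_delta.
apply: (big_ind2 good) => // i _; apply: (big_ind2 good) => // j _ B' mB'.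
by apply: indep_law_shift_entry => //; exact: shift1.
Qed.

(** * Translation of the Laplace law *)

Lemma lebesgue_measure_shift {R : realType} (c : R) (A : set R) :
  measurable A ->
  pushforward lebesgue_measure (+%R^~ c : _ -> measurableTypeR R) A =
  lebesgue_measure A.
Proof.
move=> mA; apply/esym/lebesgue_measure_unique => //=.
  exact: measurable_funD.
move=> _ _ [[a b]] _ <-.
rewrite /pushforward (_ : _ @^-1` _ = `]a - c, b - c]%classic); last first.
  by apply/seteqP; split => x /=; rewrite !in_itv/= ltrBlDr lerBrDr.
rewrite !lebesgue_measure_itv/= !lte_fin ltrD2r.
by case: ifP => // _; rewrite -!EFinB opprB addrA subrK.
Qed.

Lemma measurable_laplace_density {R : realType} (b : R) (D : set R) :
  measurable_fun D (fun x : R => (expR (- `|x| / b) / (2 * b))%:E).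
Proof.
apply/measurable_EFinP/measurable_funTS/measurable_funM => //.
apply: measurableT_comp => //; apply: measurable_funM => //.
exact: measurableT_comp.
Qed.

(** Substituting [x + c] on the right puts both integrals over the same set; the densities then
    compare pointwise by the triangle inequality for [x + c]. *)
Lemma laplace_law_shift {R : realType} (b c : R) (A : set R) :
  0 < b -> measurable A ->
  (laplace_law b [set x | A (x + c)%R]
     <= (expR (`|c| / b))%:E * laplace_law b A)%E.
Proof.
move=> b0 mA; rewrite /laplace_law b0.
pose f (x : R) := (expR (- `|x| / b) / (2 * b))%:E.
pose tau : R -> measurableTypeR R := +%R^~ c.
have mtau : measurable_fun setT tau by exact: measurable_funD.
have mAc : measurable (tau @^-1` A).
  by rewrite -[X in measurable X]setTI; exact: mtau.
have f0 x : (0 <= f x)%E.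
  by rewrite lee_fin divr_ge0 ?expR_ge0// mulr_ge0// ltW.
rewrite -[leLHS]/(\int[lebesgue_measure]_(x in tau @^-1` A) f x)%E.
rewrite -[X in (_ <= _ * X)%E]/(\int[lebesgue_measure]_(x in A) f x)%E.
rewrite [X in (_ <= _ * X)%E](_ : _ =
    \int[lebesgue_measure]_(x in tau @^-1` A) (f \o tau) x)%E; last first.
  rewrite -ge0_integral_pushforward//; last exact: measurable_laplace_density.
  apply: eq_measure_integral => B mB _.
  by rewrite [RHS]lebesgue_measure_shift.
have mftau : measurable_fun (tau @^-1` A) (f \o tau).
  apply: measurable_funTS; apply: (measurableT_comp _ mtau).
  exact: measurable_laplace_density.
rewrite -ge0_integralZl//; last by move=> x _; exact: f0.
apply: ge0_le_integral => //.
- exact: measurable_laplace_density.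
- exact: measurable_funeM.
move=> x _; rewrite /f /= -EFinM lee_fin mulrA ler_pM2r ?invr_gt0 ?mulr_gt0//.
rewrite -expRD ler_expR -mulrDl ler_pM2r ?invr_gt0// /tau.
by rewrite lerBrDl lerBlDr addrC ler_normD.
Qed.

(** * Frobenius geometry and the update as a projection *)

Lemma frob_sq_ge0 {R : realType} {J K : nat} (A : 'M[R]_(J, K)) : 0 <= frob_sq A.
Proof. by apply: sumr_ge0 => i _; apply: sumr_ge0 => j _; rewrite -expr2 sqr_ge0. Qed.

Lemma sqr_entry_le_frob_sq {R : realType} {J K : nat} (A : 'M[R]_(J, K)) i j :
  (A i j) ^+ 2 <= frob_sq A.
Proof.
rewrite /frob_sq /frob (bigD1 i)//= (bigD1 j)//= -expr2 -addrA lerDl.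
apply: addr_ge0; first by apply: sumr_ge0 => k _; rewrite -expr2 sqr_ge0.
by apply: sumr_ge0 => k _; apply: sumr_ge0 => l _; rewrite -expr2 sqr_ge0.
Qed.

(** The last bracket is free of [z], so minimizing the objective over a set amounts to projecting
    its unconstrained minimizer [a] onto that set. *)
Lemma prox_objective_square {R : realType} {J K : nat}
    (g w1 lam zt x z : 'M[R]_(J, K)) (rho eta : R) :
  0 < rho -> 0 < eta ->
  let s := rho + eta^-1 in
  let a := s^-1 *: (rho *: w1 + lam + eta^-1 *: zt - (g + x)) in
  frob g z + rho / 2 * frob_sq (w1 - z + rho^-1 *: (lam - x))
    + (2 * eta)^-1 * frob_sq (z - zt) =
  s / 2 * frob_sq (z - a)
    + (rho / 2 * frob_sq (w1 + rho^-1 *: (lam - x))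
       + (2 * eta)^-1 * frob_sq zt - s / 2 * frob_sq a).
Proof.
move=> rho0 eta0 s a.
have s0 : rho * eta + 1 != 0 by rewrite gt_eqF// ltr_wpDl// mulr_ge0// ltW.
rewrite /frob_sq /frob !mulr_sumr -!big_split -sumrB -!big_split/=.
apply: eq_bigr => i _; rewrite !mulr_sumr -!big_split -sumrB -!big_split/=.
apply: eq_bigr => j _; rewrite /a /s !mxE.
field.
by rewrite s0 !gt_eqF.
Qed.

Definition is_projection {R : realType} {J K : nat} (W : set 'M[R]_(J, K))
    (a u : 'M[R]_(J, K)) : Prop :=
  W u /\ forall z, W z -> frob_sq (u - a) <= frob_sq (z - a).

(** First-order optimality: were the inner product negative, a step from [u] towards [z] would stay
    in [W] and come closer to [a]. *)
Lemma projection_variational {R : realType} {J K : nat} (W : set 'M[R]_(J, K))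
    (a u z : 'M[R]_(J, K)) :
  mx_convex_set W -> is_projection W a u -> W z -> 0 <= frob (u - a) (z - u).
Proof.
move=> cW [Wu min] Wz; rewrite leNgt; apply/negP => neg.
set q := frob (u - a) (z - u) in neg *; pose N := frob_sq (z - u).
have N0 : 0 <= N := frob_sq_ge0 _.
(* The unconstrained optimal step would be [- q / N]; the larger denominator forces [t <= 1], also
   covers [N = 0], and still gives [2 * q + t * N <= q < 0]. *)
pose t := - q / (N - q).
have Nq : 0 < N - q by lra.
have t0 : 0 < t by rewrite divr_gt0//; lra.
have t1 : t <= 1 by rewrite ler_pdivrMr//; lra.
have /min : W (t *: z + (1 - t) *: u) by apply: cW => //; rewrite (ltW t0) t1.
have -> : frob_sq (t *: z + (1 - t) *: u - a) =
    frob_sq (u - a) + (2 * t * q + t ^+ 2 * N).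
  rewrite /q /N /frob_sq /frob !mulr_sumr -!big_split/=.
  apply: eq_bigr => i _; rewrite !mulr_sumr -!big_split/=.
  by apply: eq_bigr => j _; rewrite !mxE; ring.
rewrite lerDl; apply/negP; rewrite -ltNge.
have -> : 2 * t * q + t ^+ 2 * N = t * (2 * q + t * N) by ring.
rewrite pmulr_rlt0//.
have : t * N <= - q by rewrite mulrAC ler_pdivrMr// ler_pM2l; lra.
by lra.
Qed.

(** The two variational inequalities are added; what remains of [frob_sq (a - b)] beyond
    [frob_sq (u - v)] is then a square plus nonnegative terms. *)
Lemma projection_nonexpansive {R : realType} {J K : nat} (W : set 'M[R]_(J, K))
    (a b u v : 'M[R]_(J, K)) :
  mx_convex_set W -> is_projection W a u -> is_projection W b v ->
  frob_sq (u - v) <= frob_sq (a - b).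
Proof.
move=> cW pu pv.
have h1 := projection_variational _ _ _ _ cW pu pv.1.
have h2 := projection_variational _ _ _ _ cW pv pu.1.
have h3 := frob_sq_ge0 (a - b - (u - v)).
suff : frob_sq (a - b) = frob_sq (u - v) + (frob_sq (a - b - (u - v))
    + 2 * (frob (u - a) (v - u) + frob (v - b) (u - v))) by lra.
rewrite mulrDr /frob_sq /frob !mulr_sumr -!big_split/=.
apply: eq_bigr => i _; rewrite !mulr_sumr -!big_split/=.
by apply: eq_bigr => j _; rewrite !mxE; ring.
Qed.

Lemma projection_unique {R : realType} {J K : nat} (W : set 'M[R]_(J, K))
    (a u v : 'M[R]_(J, K)) :
  mx_convex_set W -> is_projection W a u -> is_projection W a v -> u = v.
Proof.
move=> cW pu pv; have := projection_nonexpansive _ _ _ _ _ cW pu pv.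
have -> : frob_sq (a - a) = 0.
  rewrite subrr /frob_sq /frob big1// => i _.
  by rewrite big1// => j _; rewrite mxE mulr0.
move=> uv0; apply/matrixP => i j; apply/eqP; rewrite -subr_eq0 -sqrf_eq0.
rewrite eq_le sqr_ge0 andbT (le_trans _ uv0)//.
by have := sqr_entry_le_frob_sq (u - v) i j; rewrite !mxE.
Qed.

(** [C] is the square of a Lipschitz constant. The topology on matrices is that of the largest
    entry, whose square is within a factor [J * K] of [frob_sq]. *)
Lemma frob_lipschitz_continuous {R : realType} {J K : nat} (C : R)
    (f : 'M[R]_(J, K) -> 'M[R]_(J, K)) :
  0 <= C -> (forall x y, frob_sq (f x - f y) <= C * frob_sq (x - y)) ->
  continuous f.
Proof.
move=> C0 lip x U /nbhs_ballP[e /= e0 eU]; apply/nbhs_ballP.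
pose q : R := C * (J * K)%:R.
have q0 : 0 <= q by rewrite mulr_ge0.
(* Chosen so that [q * dlt ^+ 2 < e ^+ 2]; adding 1 keeps the quotient meaningful when [q = 0]. *)
pose dlt := e / (q + 1).
have d0 : 0 < dlt by rewrite divr_gt0// ltr_wpDl.
exists dlt => //= y [_ xy]; apply: eU; split => // i j.
rewrite /ball/= -(@ltr_pXn2r _ 2)// ?nnegrE ?normr_ge0 ?ltW// real_normK ?num_real//.
have := sqr_entry_le_frob_sq (f x - f y) i j; rewrite !mxE => /le_lt_trans; apply.
apply: (le_lt_trans (lip x y)).
have : frob_sq (x - y) <= (J * K)%:R * dlt ^+ 2.
  rewrite mulr_natl mulnC mulrnA -[X in _ *+ X]card_ord -sumr_const.
  apply: ler_sum => k _; rewrite -[X in _ *+ X]card_ord -sumr_const.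
  apply: ler_sum => l _; rewrite !mxE -expr2 -[leLHS]real_normK ?num_real//.
  by rewrite lerXn2r ?nnegrE ?normr_ge0 ?ltW//; exact: xy.
move=> /(ler_wpM2l C0)/le_lt_trans; apply; rewrite mulrA -/q.
rewrite /dlt expr_div_n mulrCA gtr_pMr ?exprn_gt0//.
rewrite ltr_pdivrMr ?exprn_gt0 ?ltr_wpDl// mul1r.
by nra.
Qed.

(** * The Laplace mechanism and the privacy bound *)

Lemma entry_le_l1norm {R : realType} {J K : nat} (c : 'M[R]_(J, K)) i j :
  `|c i j| <= l1norm c.
Proof.
rewrite /l1norm (bigD1 i)//= (bigD1 j)//= -addrA lerDl addr_ge0//.
  exact: sumr_ge0.
by apply: sumr_ge0 => k _; exact: sumr_ge0.
Qed.

Lemma l1norm_sub_sym {R : realType} {J K : nat} (A B : 'M[R]_(J, K)) :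
  l1norm (A - B) = l1norm (B - A).
Proof.
by apply: eq_bigr => i _; apply: eq_bigr => j _; rewrite !mxE distrC.
Qed.

(** With scale [Delta / eps], shifting entry [(i, j)] costs the exponent [|c i j| * eps / Delta];
    these sum to [l1norm c * eps / Delta], at most [eps]. *)
Lemma laplace_mechanism {R : realType} {J K : nat} {d : measure_display}
    {Omega : measurableType d} (Pr : probability Omega R)
    (xi : Omega -> 'M[R]_(J, K)) (Delta eps : R) (c : 'M[R]_(J, K))
    (B : set 'M[R]_(J, K)) :
  0 < eps ->
  (forall i j, is_laplace_rv Pr (fun w => xi w i j) (Delta / eps)) ->
  mx_entries_indep Pr xi -> l1norm c <= Delta -> mx_measurable B ->
  (Pr [set w | B (xi w + c)%R] <= (expR eps)%:E * Pr [set w | B (xi w)])%E.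
Proof.
move=> eps0 lap ind cD mB.
have mxi : measurable_fun setT (xi : Omega -> borel_mx R J K).
  by apply: measurable_fun_mx => i j; exact: (lap i j).1.
pose X : {mfun Omega >-> borel_mx R J K} := mfun_Sub (mem_set mxi).
pose mu : probability (borel_mx R J K) R := distribution Pr X.
have mA (A : set R) (y : R) : measurable A -> measurable [set x | A (x + y)].
  move=> mA; rewrite -[X in measurable X]setTI.
  have mD : measurable_fun setT (fun x : R => x + y) by exact: measurable_funD.
  exact: mD.
have l1c0 : 0 <= l1norm c by apply: sumr_ge0 => i _; exact: sumr_ge0.
(* For Delta = 0 the noise is a Dirac mass, but then the shift is trivial. *)
have [D0|D0] := leP Delta 0.
  have -> : c = 0.
    apply/matrixP => i j; apply/eqP; rewrite mxE -normr_le0.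
    exact: le_trans (entry_le_l1norm c i j) (le_trans cD D0).
  under eq_set do rewrite addr0.
  rewrite -[leLHS]mul1e lee_pmul//.
  by rewrite lee_fin -expR0 ler_expR ltW.
have b0 : 0 < Delta / eps by rewrite divr_gt0.
have := indep_law_shift mu c (fun i j => `|c i j| / (Delta / eps)) B ind.
move=> /(_ _ mB) /le_trans; apply.
  move=> i j A mA'.
  rewrite -[leLHS]/(Pr ((fun w => xi w i j) @^-1` [set x | A (x + c i j)%R])).
  rewrite -[X in (_ <= _ * X)%E]/(Pr ((fun w => xi w i j) @^-1` A)).
  rewrite !(lap i j).2//; last exact: mA.
  exact: laplace_law_shift.
apply: lee_pmul => //; rewrite lee_fin ler_expR.
under eq_bigr do rewrite -mulr_suml.
rewrite -mulr_suml -/(l1norm c) ler_pdivrMr//.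
by rewrite mulrCA divff ?gt_eqF// mulr1.
Qed.

Theorem theorem1
  (R : realType) (J K : nat) (hJ : (0 < J)%N) (hK : (0 < K)%N)
  (P : nat) (Isz : 'I_P -> nat) (p : 'I_P)
  (phi : 'M[R]_(J, K) -> 'rV[R]_J -> 'rV[R]_K -> R) (r : 'M[R]_(J, K) -> R)
  (beta : R) (hbeta : 0 < beta)
  (hphi : forall (x : 'rV[R]_J) (y : 'rV[R]_K), mx_convex_fun (fun z => phi z x y))
  (hr : mx_convex_fun r)
  (fsub : 'M[R]_(J, K) -> dataset R J K (Isz p) -> 'M[R]_(J, K))
  (hsub : forall (z : 'M[R]_(J, K)) (D0 : dataset R J K (Isz p)),
     is_subgradient
       (f_loc (\sum_(q < P) Isz q)%N P beta phi r D0) z (fsub z D0))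
  (M : nat) (h : 'I_M -> 'M[R]_(J, K) -> R) (W : set 'M[R]_(J, K))
  (hW : W = [set z | forall m, h m z <= 0])
  (hh : forall m, mx_convex_fun (h m) /\ mx_C2 (h m))
  (hWcomp : compact W) (hWconv : mx_convex_set W)
  (w1 lam zt : 'M[R]_(J, K)) (rho eta eps Delta : R)
  (hrho : 0 < rho) (heta : 0 < eta) (heps : 0 < eps)
  (D : dataset R J K (Isz p))
  (hDelta : (exists D' : dataset R J K (Isz p), neighbor D D' /\
               l1norm (fsub zt D - fsub zt D') = Delta) /\
            (forall D' : dataset R J K (Isz p), neighbor D D' ->
               l1norm (fsub zt D - fsub zt D') <= Delta))
  (zmap : dataset R J K (Isz p) -> 'M[R]_(J, K) -> 'M[R]_(J, K))
  (hz : forall (D0 : dataset R J K (Isz p)) (xi0 : 'M[R]_(J, K)),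
     W (zmap D0 xi0) /\
     forall z, W z ->
       frob (fsub zt D0) (zmap D0 xi0)
         + rho / 2 * frob_sq (w1 - zmap D0 xi0 + rho^-1 *: (lam - xi0))
         + (2 * eta)^-1 * frob_sq (zmap D0 xi0 - zt)
       <= frob (fsub zt D0) z
         + rho / 2 * frob_sq (w1 - z + rho^-1 *: (lam - xi0))
         + (2 * eta)^-1 * frob_sq (z - zt))
  (d : measure_display) (Omega : measurableType d) (Pr : probability Omega R)
  (xi : Omega -> 'M[R]_(J, K))
  (hxi : forall (i : 'I_J) (j : 'I_K),
     is_laplace_rv Pr (fun w => xi w i j) (Delta / eps))
  (hind : mx_entries_indep Pr xi) :
  forall S : set 'M[R]_(J, K), mx_measurable S ->
  forall D' : dataset R J K (Isz p), neighbor D D' ->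
    ((expR (- eps))%:E * Pr [set w | S (zmap D' (xi w))]
       <= Pr [set w | S (zmap D (xi w))])%E /\
    (Pr [set w | S (zmap D (xi w))]
       <= (expR eps)%:E * Pr [set w | S (zmap D' (xi w))])%E.
Proof.
pose s := rho + eta^-1.
have s0 : 0 < s by rewrite addr_gt0// invr_gt0.
pose a D0 x := s^-1 *: (rho *: w1 + lam + eta^-1 *: zt - (fsub zt D0 + x)).
have proj D0 x : is_projection W (a D0 x) (zmap D0 x).
  have [Wz min] := hz D0 x; split => // z Wz'.
  have := min z Wz'.
  rewrite !(prox_objective_square _ _ _ _ _ _ _ _ hrho heta) -/s -/(a D0 x).
  by rewrite lerD2r ler_pM2l// divr_gt0.
have zmap_cont D0 : continuous (zmap D0).
  (* The projected point [a D0 x] is affine in [x] with slope [- s^-1], hence the squared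
     constant. *)
  apply: (@frob_lipschitz_continuous _ _ _ ((s^-1) ^+ 2)).
    by rewrite sqr_ge0.
  move=> x y.
  apply: (le_trans
    (projection_nonexpansive _ _ _ _ _ hWconv (proj D0 x) (proj D0 y))).
  rewrite le_eqVlt; apply/orP; left; apply/eqP.
  rewrite /frob_sq /frob mulr_sumr; apply: eq_bigr => i _; rewrite mulr_sumr.
  by apply: eq_bigr => j _; rewrite /a !mxE; ring.
(* The projected point depends on data and noise only through [fsub zt D0 + x], so a change of
   dataset can be absorbed into the noise; uniqueness of projections concludes. *)
have zmap_shift D1 D2 x :
    zmap D2 x = zmap D1 (x + (fsub zt D2 - fsub zt D1)).
  apply: (projection_unique _ _ _ _ hWconv (proj D2 x)).
  suff <- : a D1 (x + (fsub zt D2 - fsub zt D1)) = a D2 x by exact: proj.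
  rewrite /a; congr (_ *: (_ - _)).
  by rewrite addrCA [fsub zt D1 + _]addrC subrK addrC.
move=> S mS D' DD'.
have dist : l1norm (fsub zt D - fsub zt D') <= Delta by exact: hDelta.2.
(* Stated for an arbitrary pair so that it serves in both directions, the l1 distance being
   symmetric. *)
have priv D1 D2 : l1norm (fsub zt D2 - fsub zt D1) <= Delta ->
    (Pr [set w | S (zmap D2 (xi w))]
       <= (expR eps)%:E * Pr [set w | S (zmap D1 (xi w))])%E.
  move=> D12; under eq_set do rewrite (zmap_shift D1).
  apply: (laplace_mechanism _ _ _ _ _ (zmap D1 @^-1` S) heps hxi hind D12).
  rewrite -[X in mx_measurable X]setTI.
  exact: (continuous_mx_measurable _ (zmap_cont D1)).
split; last by apply: priv.
(* The lower bound is the reversed upper bound multiplied by [expR (- eps)]. *)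
have := priv D D'; rewrite l1norm_sub_sym => /(_ dist) h1.
rewrite -[leRHS]mul1e -(expR0 R) -(addNr eps) expRD EFinM -muleA.
by apply: lee_pmul => //; rewrite lee_fin expR_ge0.
Qed.
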